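(* Let $X$ be a Banach space. Suppose that for every $x\in S_X$ and every convex combination of slices $C$ of $B_X$ we have $\sup_{y\in C}\max_{\theta\in\mathbb{T}}\|x+\theta y\|=2$. Then $X$ has the Daugavet property.
   Context: Banach spaces are non-zero and over $\mathbb{K}$ ($\mathbb{R}$ or $\mathbb{C}$); $B_X$, $S_X$ denote the closed unit ball and the unit sphere of $X$; $\mathbb{T}=\{\theta\in\mathbb{K}:|\theta|=1\}$. A slice of $B_X$ is a set of the form $\{y\in B_X:\mathrm{Re}\,x^*(y)>\sup\mathrm{Re}\,x^*(B_X)-\alpha\}$ with $x^*\in X^*\setminus\{0\}$ and $\alpha>0$. A convex combination of slices of $B_X$ is a set $\sum_{i=1}^n\lambda_iS_i$ with $n\in\mathbb{N}$, $S_i$ slices of $B_X$, $\lambda_i>0$ and $\sum_{i=1}^n\lambda_i=1$. $X$ has the Daugavet property if $\|\mathrm{Id}+T\|=1+\|T\|$ for every bounded rank-one operator $T\colon X\to X$. *)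

(* Defs.v *)
From HB Require Import structures.
From mathcomp Require Import all_boot all_order all_algebra.
From mathcomp Require Import all_classical all_reals all_analysis.
From mathcomp Require Import complex.

Set Implicit Arguments.
Unset Strict Implicit.
Unset Printing Implicit Defensive.

Import Order.TTheory GRing.Theory Num.Theory.
Import numFieldNormedType.Exports.

Local Open Scope classical_set_scope.
Local Open Scope ring_scope.

(* The scalar field is either R or C = R[i]; a Banach space over it is a
   [completeNormedModType (scalar_field R k)].  The library norm of such a
   space takes its values in the scalar field itself: when K = R[i], [`|x|] is a
   complex number with zero imaginary part, and [<=], [<] on R[i] compare only
   numbers with the same imaginary part. *)
Inductive scalar_kind := RealScalars | ComplexScalars.

Definition scalar_field (R : realType) (k : scalar_kind) : numFieldType :=
  match k with
  | RealScalars => R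
  | ComplexScalars => R[i]
  end.

Definition re (R : realType) (k : scalar_kind) : scalar_field R k -> R :=
  match k with
  | RealScalars => fun a : R => a
  | ComplexScalars => fun a : R[i] => complex.Re a
  end.

Section Daugavet.
Context {R : realType} {k : scalar_kind}.
Local Notation K := (scalar_field R k).
Implicit Type X : normedModType K.

Definition rnorm X (x : X) : R := re `|x|.

Definition unit_ball X : set X := [set y | `|y| <= 1].
Definition unit_sphere X : set X := [set x | `|x| = 1].

Definition unit_scalars : set K := [set theta | `|theta| = 1].

Definition slice X (f : {linear X -> K^o}) (alpha : R) : set X :=
  [set y | unit_ball y /\
     sup [set re (f z) | z in @unit_ball X] - alpha < re (f y)].

Definition is_slice X (S : set X) : Prop :=
  exists (f : {linear X -> K^o}) (alpha : R),
    [/\ continuous f, exists x, f x != 0, 0 < alpha & S = slice f alpha].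

(* [0 < lambda i] forces the weights to be real, also when K = R[i]; the sum
   condition forces [0 < n]. *)
Definition is_convex_combination_of_slices X (C : set X) : Prop :=
  exists (n : nat) (lambda : 'I_n -> K) (S : 'I_n -> set X),
    [/\ forall i, 0 < lambda i,
        \sum_(i < n) lambda i = 1,
        forall i, is_slice (S i) &
        C = [set y | exists s : 'I_n -> X,
               (forall i, S i (s i)) /\ y = \sum_(i < n) lambda i *: s i]].

(* The supremum is a maximum, since the set of unit scalars is compact. *)
Definition max_rotation_norm X (x y : X) : R :=
  sup [set rnorm (x + theta *: y) | theta in unit_scalars].

Definition operator_norm X (T : X -> X) : R :=
  sup [set rnorm (T x) | x in @unit_ball X].

Definition is_rank_one X (T : X -> X) : Prop :=
  exists v : X, v != 0 /\ range T = [set a *: v | a in [set: K]].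

Definition Daugavet_property X : Prop :=
  forall T : {linear X -> X}, continuous T -> is_rank_one T ->
    operator_norm (fun x => x + T x) = 1 + operator_norm T.

End Daugavet.

Arguments unit_ball {R k} X.
Arguments unit_sphere {R k} X.
Arguments Daugavet_property {R k} X.

(* Main.v *)
(* Let S be a slice, x a unit vector and z_1, ..., z_n a fine net of the unit
   scalars.  The sets z_j^-1 S are slices; apply the hypothesis to their average.
   It gives theta and points y_j of S such that
   (1/n) sum_j (x + theta z_j^-1 y_j) has norm near 2, hence so does every summand.
   Some z_j is close to theta, and for this j the vector x + y_j has norm near 2.
   If T = f(.) u with |u| = 1, apply this to x = u and a slice on which f is near
   its norm a: then y + T y is near y + a u, which has norm near 1 + a. *)
From HB Require Import structures.
Require Import Defs.
From mathcomp Require Import all_boot all_order all_algebra.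
From mathcomp Require Import all_classical all_reals all_analysis.
From mathcomp Require Import complex ring lra.

Set Implicit Arguments.
Unset Strict Implicit.
Unset Printing Implicit Defensive.

Import Order.TTheory GRing.Theory Num.Theory.
Import numFieldNormedType.Exports.

Local Open Scope classical_set_scope.
Local Open Scope ring_scope.

(** * Real numbers as scalars, and real-valued norms *)

Definition of_real (R : realType) (k : scalar_kind) : R -> scalar_field R k :=
  match k with
  | RealScalars => fun a : R => a
  | ComplexScalars => fun a : R => (a%:C)%C
  end.

Arguments of_real {R} k.

Lemma re_of_real (R : realType) k (a : R) : re (of_real k a) = a.
Proof. by case: k. Qed.

Lemma of_real_nat (R : realType) k n : of_real k n%:R = n%:R :> scalar_field R k.
Proof. by case: k => //=; rewrite rmorph_nat. Qed.

Lemma of_real0 (R : realType) k : of_real k 0 = 0 :> scalar_field R k.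
Proof. by case: k. Qed.

Lemma of_real1 (R : realType) k : of_real k 1 = 1 :> scalar_field R k.
Proof. by case: k. Qed.

Lemma of_realV (R : realType) k (a : R) : of_real k a^-1 = (of_real k a)^-1.
Proof. by case: k => //=; rewrite fmorphV. Qed.

Lemma norm_of_real (R : realType) k (a : R) : 0 <= a -> `|of_real k a| = of_real k a.
Proof. by move=> a0; apply: ger0_norm; case: k => //=; rewrite ler0c. Qed.

(** A nonnegative element of [R[i]] has zero imaginary part. Hence [rnorm] loses nothing of the
    scalar-valued norm, and estimates can be made in [R]. *)
Lemma of_real_re (R : realType) k (z : scalar_field R k) : 0 <= z -> of_real k (re z) = z.
Proof. by case: k z => //= z z0; rewrite RRe_real// ger0_real. Qed.

Lemma re_le (R : realType) k (y z : scalar_field R k) : y <= z -> re y <= re z.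
Proof. by case: k y z => //= y z; rewrite lecE => /andP[]. Qed.

Lemma reD (R : realType) k (y z : scalar_field R k) : re (y + z) = re y + re z.
Proof. by case: k y z => //= -[? ?] [? ?]. Qed.

Lemma re_of_realM (R : realType) k (a : R) (z : scalar_field R k) :
  re (of_real k a * z) = a * re z.
Proof. by case: k z => //= -[b c]; rewrite /= mul0r subr0. Qed.

Lemma re_le_norm (R : realType) k (z : scalar_field R k) : re z <= re `|z|.
Proof.
case: k z => [|] z /=; first exact: ler_norm.
apply: (le_trans (ler_norm _)).
by have := normc_ge_Re z; rewrite lecE => /andP[].
Qed.

Lemma sqr_Re_norm (R : realType) (z : R[i]) :
  complex.Re `|z| ^+ 2 = complex.Re z ^+ 2 + complex.Im z ^+ 2.
Proof. by rewrite normc_def /= sqr_sqrtr// addr_ge0 ?sqr_ge0. Qed.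

(** The law of cosines. It turns a large real part and a bounded modulus into closeness to [a], so
    that a slice controls [f y] itself and not only its real part. *)
Lemma sqr_norm_sub_of_real (R : realType) k (z : scalar_field R k) (a : R) :
  re `|z - of_real k a| ^+ 2 = re `|z| ^+ 2 - 2 * a * re z + a ^+ 2.
Proof.
case: k z => [|] z /=.
  by rewrite !real_normK ?num_real//; ring.
rewrite [LHS](sqr_Re_norm (z - (a%:C)%C)) [in RHS](sqr_Re_norm z).
by case: z => b c /=; ring.
Qed.

Lemma rnorm_ge0 (R : realType) k (X : normedModType (scalar_field R k)) (x : X) :
  0 <= rnorm x.
Proof. by have /re_le := normr_ge0 x; rewrite -(re_of_real k 0) (of_real0 R k). Qed.

Lemma of_real_rnorm (R : realType) k (X : normedModType (scalar_field R k)) (x : X) :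
  of_real k (rnorm x) = `|x|.
Proof. exact: of_real_re. Qed.

Lemma rnormD (R : realType) k (X : normedModType (scalar_field R k)) (x y : X) :
  rnorm (x + y) <= rnorm x + rnorm y.
Proof. by rewrite -reD re_le// ler_normD. Qed.

Lemma rnormZ (R : realType) k (X : normedModType (scalar_field R k))
    (c : scalar_field R k) (x : X) :
  rnorm (c *: x) = re `|c| * rnorm x.
Proof. by rewrite {1}/rnorm normrZ -[`|c|]of_real_re// re_of_realM re_of_real. Qed.

Lemma rnormN (R : realType) k (X : normedModType (scalar_field R k)) (x : X) :
  rnorm (- x) = rnorm x.
Proof. by rewrite /rnorm normrN. Qed.

Lemma re1 (R : realType) k : re (1 : scalar_field R k) = 1.
Proof. by rewrite -(of_real1 R k) re_of_real. Qed.

Lemma unit_ballE (R : realType) k (X : normedModType (scalar_field R k)) (x : X) :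
  unit_ball X x <-> rnorm x <= 1.
Proof.
split=> [/re_le|x1]; first by rewrite re1.
rewrite /unit_ball /= -of_real_rnorm -(of_real1 R k).
by case: k X x x1 => //= X x; rewrite lecR.
Qed.

Lemma unit_sphereE (R : realType) k (X : normedModType (scalar_field R k)) (x : X) :
  unit_sphere X x <-> rnorm x = 1.
Proof.
rewrite /unit_sphere /= /rnorm; split=> [->|x1]; first exact: re1.
by rewrite -of_real_rnorm /rnorm x1 (of_real1 R k).
Qed.

(** * Finite nets of unit scalars *)

Lemma real_unit_scalar_net (R : realType) (e : R) : 0 < e ->
  exists s : seq R, (forall z, z \in s -> `|z| = 1) /\
    forall t, `|t| = 1 -> exists2 z, z \in s & `|z - t| <= e.
Proof.
move=> e0; exists [:: 1; -1]; split=> [z|t].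
  by rewrite !inE => /orP[] /eqP->; rewrite ?normrN normr1.
case: (lerP 0 t) => [t0|t0]; [rewrite ger0_norm//|rewrite ltr0_norm//] => t1.
  by exists 1; rewrite ?inE ?eqxx// t1 subrr normr0 ltW.
by exists (-1); rewrite ?inE ?eqxx ?orbT// -t1 opprK subrr normr0 ltW.
Qed.

(** Take for [p] the integer part of [(a + 1) * m]. Applied to both coordinates, this gives the
    square grid used over [R[i]]. *)
Lemma unit_interval_grid (R : realType) (m : nat) (a : R) : (0 < m)%N -> `|a| <= 1 ->
  exists2 p, (p < (2 * m).+1)%N & `|p%:R / m%:R - 1 - a| <= m%:R^-1.
Proof.
move=> m0 a1; have mR : 0 < m%:R :> R by rewrite ltr0n.
have [l u] : -1 <= a /\ a <= 1 by move: a1; rewrite ler_norml => /andP[].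
pose y := (a + 1) * m%:R.
have y0 : 0 <= y by apply: mulr_ge0; [lra|exact: ltW].
have /andP[p1 p2] := truncn_itv y0.
exists (Num.truncn y).
  rewrite ltnS -(ler_nat R) (le_trans p1)// natrM ler_wpM2r// ?(ltW mR)//.
  lra.
have -> : (Num.truncn y)%:R / m%:R - 1 - a = ((Num.truncn y)%:R - y) / m%:R.
  by rewrite /y; field; rewrite gt_eqF.
rewrite normrM [`|m%:R^-1|]gtr0_norm ?invr_gt0// ler_piMl ?invr_ge0 ?(ltW mR)//.
by rewrite ler_norml; move: p2; rewrite -natr1 => p2; apply/andP; split; lra.
Qed.

(* Normalizing the points of a square grid at most doubles their distance to a
   point of the circle. *)
Lemma complex_unit_scalar_net (R : realType) (e : R) : 0 < e ->
  exists s : seq R[i], (forall z, z \in s -> `|z| = 1) /\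
    forall t, `|t| = 1 -> exists2 z, z \in s & complex.Re `|z - t| <= e.
Proof.
(* Each coordinate is off by at most [1 / m], so the modulus by at most [2 / m]; normalizing doubles
   this to [4 / m], which is at most [e]. *)
move=> e0; pose m := (Num.truncn (4 / e)).+1.
have m0 : (0 < m)%N by [].
have mR : 0 < m%:R :> R by rewrite ltr0n.
have me : 4 / m%:R <= e.
  rewrite ler_pdivrMr// mulrC -ler_pdivrMr//.
  by have := truncnS_gt (4 / e); rewrite -/m => /ltW.
pose node (p q : nat) : R[i] := ((p%:R / m%:R - 1) +i* (q%:R / m%:R - 1))%C.
(* The origin is a grid point and has no direction. The value 1 keeps it in the net, and the
   doubling bound survives: [|1 - t| <= 2 = 2 * |0 - t|]. *)
pose normalize (z : R[i]) := if z == 0 then 1 else z / `|z|.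
exists [seq normalize (node p q) | p <- iota 0 (2 * m).+1, q <- iota 0 (2 * m).+1].
split=> [_ /allpairsP[[p q] [_ _ ->]]|t t1].
  rewrite /normalize; case: eqP => [_|/eqP z0]; first exact: normr1.
  by rewrite normrM normfV normr_id divff// normr_eq0.
have t1' : complex.Re t ^+ 2 + complex.Im t ^+ 2 = 1.
  have := add_Re2_Im2 t; rewrite t1 expr1n => /(congr1 (@complex.Re R)) /= <- //.
have aux (a b : R) : a ^+ 2 + b ^+ 2 = 1 -> `|a| <= 1.
  move=> ab; rewrite -(@ler_pXn2r _ 2)// ?nnegrE// expr1n real_normK ?num_real//.
  by rewrite -ab lerDl sqr_ge0.
have [p pm hp] := unit_interval_grid m0 (aux _ _ t1').
have [q qm hq] := unit_interval_grid m0 (aux _ _ (etrans (addrC _ _) t1')).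
exists (normalize (node p q)).
  by apply/allpairsP; exists (p, q); rewrite !mem_iota.
have zt : `|node p q - t| <= ((2 / m%:R)%:C)%C.
  rewrite normc_def lecR /= -(@ler_pXn2r _ 2)// ?nnegrE ?sqrtr_ge0//.
  rewrite sqr_sqrtr ?addr_ge0 ?sqr_ge0//.
  case: t {t1 t1'} hp hq => a b /= hp hq.
  have sq (x : R) : `|x| <= m%:R^-1 -> x ^+ 2 <= m%:R^-2.
    move=> hx; rewrite -(real_normK (num_real x)) -exprVn.
    by rewrite ler_pXn2r// nnegrE invr_ge0 (ltW mR).
  have := sq _ hp; have := sq _ hq; rewrite expr_div_n => h1 h2.
  have : 0 <= m%:R^-2 :> R by rewrite -exprVn sqr_ge0.
  lra.
suff : `|normalize (node p q) - t| <= 2 * `|node p q - t|.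
  move=> /le_trans /(_ (ler_wpM2l (ler0n _ 2) zt)).
  move=> /(@re_le R ComplexScalars) /= /le_trans; apply.
  rewrite !mulr0 !subr0; lra.
rewrite /normalize; case: eqP => [->|/eqP z0].
  by rewrite sub0r normrN t1 mulr1 (le_trans (ler_normB _ _))// normr1 t1.
(* The second summand has modulus [|1 - |node p q||], which is at most [|node p q - t|] because
   [|t| = 1]. *)
have -> : node p q / `|node p q| - t
    = (node p q - t) + node p q / `|node p q| * (1 - `|node p q|).
  by rewrite mulrBr mulr1 divfK ?normr_eq0//; ring.
rewrite (le_trans (ler_normD _ _))// mulr2n mulrDl mul1r lerD2l.
rewrite normrM normrM normfV normr_id divff ?normr_eq0// mul1r -t1.
by rewrite distrC [X in _ <= X]distrC (le_trans (ler_dist_dist _ _))// distrC.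
Qed.

Lemma unit_scalar_net (R : realType) k (e : R) : 0 < e ->
  exists s : seq (scalar_field R k), (forall z, z \in s -> `|z| = 1) /\
    forall t, `|t| = 1 -> exists2 z, z \in s & re `|z - t| <= e.
Proof.
by case: k => e0; [exact: real_unit_scalar_net|exact: complex_unit_scalar_net].
Qed.

(** * Averages of rotated slices *)

Lemma rnorm_sum (R : realType) k (X : normedModType (scalar_field R k))
    (I : finType) (F : I -> X) :
  rnorm (\sum_i F i) <= \sum_i rnorm (F i).
Proof.
elim/big_ind2: _ => [|x a y b hx hy|//].
  by rewrite /rnorm normr0 -(of_real0 R k) re_of_real.
by rewrite (le_trans (rnormD _ _))// lerD.
Qed.

(** The functional [f] composed with multiplication by [c] cuts out this set with the same [alpha]:
    the ball is invariant under rotation, so the supremum is unchanged. *)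
Lemma is_slice_rotation (R : realType) k (X : normedModType (scalar_field R k))
    (S : set X) (c : scalar_field R k) :
  `|c| = 1 -> is_slice S -> is_slice [set y | S (c *: y)].
Proof.
move=> c1 [f [alpha [fc [x fx] alpha0 ->]]].
have c0 : c != 0 by rewrite -normr_eq0 c1 oner_eq0.
have ballZ (b : scalar_field R k) (z : X) : `|b| = 1 -> unit_ball X (b *: z) = unit_ball X z.
  by move=> b1; rewrite /unit_ball /= normrZ b1 mul1r.
exists (f \o ( *:%R c))%FUN, alpha; split => //.
- by move=> y; apply: continuous_comp; [exact: scaler_continuous|exact: fc].
- by exists (c^-1 *: x); rewrite /= scalerA divff// scale1r.
- have supE : [set re (f z) | z in unit_ball X] = [set re (f (c *: z)) | z in unit_ball X].
    apply/seteqP; split=> _ [z z1 <-].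
      exists (c^-1 *: z); last by rewrite scalerA divff// scale1r.
      by rewrite ballZ// normfV c1 invr1.
    by exists (c *: z); rewrite ?ballZ.
  by rewrite /slice /= supE; apply/seteqP; split=> y /=; rewrite ballZ.
Qed.

(** This is the slice characterization of the Daugavet property. Averaging over rotations replaces
    the convex combination by a single slice and removes the unknown scalar [theta]. *)
Lemma slice_near_opposite (R : realType) k (X : normedModType (scalar_field R k))
    (sup_max_eq2 : forall (x : X) (C : set X),
       unit_sphere X x -> is_convex_combination_of_slices C ->
       sup [set max_rotation_norm x y | y in C] = 2)
    (x : X) (S : set X) (d : R) :
  unit_sphere X x -> is_slice S -> 0 < d ->
  exists2 y, S y & 2 - d < rnorm (x + y).
Proof.
move=> x1 sS d0.
have S1 z : S z -> rnorm z <= 1.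
  by case: sS => [f [alpha [_ _ _ ->]]] [/unit_ballE].
have [s [s1 snet]] := @unit_scalar_net R k (d / 2) (divr_gt0 d0 (ltr0n _ 2)).
pose n := size s; pose c (i : 'I_n) := s`_i.
have c1 i : `|c i| = 1 by apply: s1; rewrite mem_nth.
have n0 : (0 < n)%N.
  by have [z] := snet 1 (normr1 _); rewrite /n; case: (s).
have nR : 0 < n%:R :> R by rewrite ltr0n.
have nK : n%:R != 0 :> scalar_field R k by rewrite pnatr_eq0 -lt0n.
pose C := [set y | exists t : 'I_n -> X,
  (forall i, S (c i *: t i)) /\ y = \sum_(i < n) n%:R^-1 *: t i].
have CC : is_convex_combination_of_slices C.
  exists n, (fun=> n%:R^-1), (fun i => [set y | S (c i *: y)]); split => //.
  - by move=> i; rewrite invr_gt0 ltr0n.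
  - by rewrite sumr_const card_ord -[RHS](mulVf nK) mulr_natr.
  - by move=> i; exact: is_slice_rotation.
have supC := sup_max_eq2 _ _ x1 CC.
(* If [n] numbers, each at most 2, have a sum above [n * (2 - eta) = 2 * n - d / 2], then each of
   them exceeds [2 - d / 2]. *)
pose eta := d / 2 / n%:R.
have eta0 : 0 < eta by rewrite !divr_gt0.
have : 2 - eta < sup [set max_rotation_norm x y | y in C] by rewrite supC; lra.
move=> /sup_gt[|_ [_ [t [tS ->]] <-]].
  (* [C] is nonempty, since the supremum of the empty set is 0 by default. *)
  apply/set0P/eqP => C0; move: supC; rewrite C0 sup0 => /eqP.
  by rewrite eq_sym pnatr_eq0.
move=> /sup_gt[|_ [theta theta1 <-]].
  by exists (rnorm (x + 1 *: \sum_(i < n) n%:R^-1 *: t i)), 1; rewrite // /unit_scalars /= normr1.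
have tn i : rnorm (t i) <= 1.
  by have := S1 _ (tS i); rewrite rnormZ c1 re1 mul1r.
have -> : x + theta *: (\sum_(i < n) n%:R^-1 *: t i)
    = \sum_(i < n) n%:R^-1 *: (x + theta *: t i).
  under [RHS]eq_bigr do rewrite scalerDr.
  rewrite big_split /= sumr_const card_ord scalerMnl -[_^-1 *+ _]mulr_natr mulVf// scale1r.
  rewrite scaler_sumr; congr (_ + _); apply: eq_bigr => i _.
  by rewrite !scalerA mulrC.
move=> hlt.
have hsum : n%:R * (2 - eta) < \sum_(i < n) rnorm (x + theta *: t i).
  rewrite mulrC -ltr_pdivlMr// (lt_le_trans hlt)// (le_trans (rnorm_sum _))//.
  rewrite mulr_suml ler_sum// => i _.
  rewrite rnormZ -of_real_nat -of_realV norm_of_real ?invr_ge0 ?ler0n//.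
  by rewrite re_of_real mulrC.
have le2 i : rnorm (x + theta *: t i) <= 2.
  rewrite (le_trans (rnormD _ _))// rnormZ theta1 re1 mul1r.
  by rewrite (proj1 (unit_sphereE _) x1); have := tn i; lra.
have [z zs hz] := snet theta theta1.
have zn : (index z s < n)%N by rewrite index_mem.
pose i0 := Ordinal zn.
have ci0 : c i0 = z by rewrite /c /= nth_index.
exists (c i0 *: t i0); first exact: tS.
have big_i0 : 2 - d / 2 < rnorm (x + theta *: t i0).
  have hrest : \sum_(i < n | i != i0) rnorm (x + theta *: t i) <= (n%:R - 1) * 2.
    apply: (le_trans (ler_sum _ (fun i _ => le2 i))).
    rewrite sumr_const cardC1 card_ord -subn1 -[2 *+ _]mulr_natr natrB//.
    by rewrite mulrC.
  move: hsum; rewrite (bigD1 i0)//= mulrBr.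
  have -> : n%:R * eta = d / 2 by rewrite /eta mulrC divfK// gt_eqF.
  by move: hrest; lra.
(* Replacing [theta] by [c i0] costs at most [d / 2], the mesh of the net. *)
have : rnorm (x + theta *: t i0) <= rnorm (x + c i0 *: t i0) + d / 2.
  have -> : x + theta *: t i0 = (x + c i0 *: t i0) + (theta - c i0) *: t i0.
    by rewrite scalerBl -addrA [_ + (_ - _)]addrC subrK.
  rewrite (le_trans (rnormD _ _))// lerD2l rnormZ distrC ci0.
  rewrite (le_trans _ hz)// ler_piMr//.
  exact: (@rnorm_ge0 R k (scalar_field R k)^o).
by move: big_i0; lra.
Qed.

(** * Rank-one operators as a functional times a unit vector *)

(** Normalize a generator of the range to get [u]. The coefficient of [T x] along [u] is unique,
    hence linear in [x], and has the modulus [|T x|], so it inherits continuity from [T]. *)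
Lemma rank_one_functional (R : realType) k (X : normedModType (scalar_field R k))
    (T : {linear X -> X}) : continuous T -> is_rank_one T ->
  exists (f : {linear X -> (scalar_field R k)^o}) (u : X),
    [/\ continuous f, exists x, f x != 0, rnorm u = 1 & forall x, T x = f x *: u].
Proof.
move=> Tc [v [v0 rT]].
have nv : `|v| != 0 by rewrite normr_eq0.
pose u := `|v|^-1 *: v.
have u1 : rnorm u = 1 by rewrite /rnorm normrZ normfV normr_id mulVf// re1.
have u0 : u != 0 by rewrite scaler_eq0 negb_or invr_eq0 nv.
have vu : v = `|v| *: u by rewrite scalerA divff// scale1r.
have Tu x : exists a, T x = a *: u.
  have [a _ <-] : [set a *: v | a in [set: scalar_field R k]] (T x) by rewrite -rT; exists x.
  by exists (a * `|v|); rewrite -scalerA -vu.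
have [g gE] := choice Tu.
have uI a b : a *: u = b *: u -> a = b.
  by move/eqP; rewrite -subr_eq0 -scalerBl scaler_eq0 (negbTE u0) orbF subr_eq0 => /eqP.
have g_lin : linear (g : X -> (scalar_field R k)^o).
  by move=> a x y; apply: uI; rewrite -gE linearP !gE scalerDl scalerA.
pose L := GRing.isLinear.Build _ _ _ _ (g : X -> (scalar_field R k)^o) g_lin.
pose f : {linear X -> (scalar_field R k)^o} := HB.pack g L.
have gT x : `|g x| = `|T x|.
  by rewrite gE normrZ -(of_real_rnorm u) u1 of_real1 mulr1.
exists f, u; split => //.
- apply/linear_bounded_continuous/linear_boundedP.
  have /linear_bounded_continuous/linear_boundedP := Tc.
  by apply: filterS => r h x; rewrite gT.
- have [x _ Tx] : range T v by rewrite rT; exists 1; rewrite ?scale1r.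
  exists x; apply/eqP => gx0; move: v0; rewrite -Tx gE.
  by rewrite [g x]gx0 scale0r eqxx.
Qed.

(* [(1 + a) (u + y) = (y + a u) + (u + a y)], and the last term has norm at most
   [1 + a]. *)
Lemma rnorm_unbalanced_sum (R : realType) k (X : normedModType (scalar_field R k))
    (u y : X) (a d : R) : 0 <= a -> rnorm u <= 1 -> rnorm y <= 1 ->
  2 - d < rnorm (u + y) -> (1 + a) * (1 - d) <= rnorm (y + of_real k a *: u).
Proof.
move=> a0 u1 y1 hd; set b := of_real k a.
have nb : re `|b| = a by rewrite norm_of_real// re_of_real.
have : rnorm ((1 + b) *: (u + y)) <= rnorm (y + b *: u) + rnorm (u + b *: y).
  apply: le_trans (rnormD _ _); rewrite scalerDl scale1r !scalerDr.
  by rewrite [u + y]addrC addrACA.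
have -> : 1 + b = of_real k (1 + a) by rewrite /b; case: (k) => //=; rewrite rmorphD.
rewrite rnormZ norm_of_real ?addr_ge0// re_of_real.
have : rnorm (u + b *: y) <= 1 + a.
  by rewrite (le_trans (rnormD _ _))// lerD// rnormZ nb ler_piMr.
have : (1 + a) * (2 - d) <= (1 + a) * rnorm (u + y).
  by rewrite ler_wpM2l ?addr_ge0// ltW.
lra.
Qed.

(** * Suprema of functionals over the unit ball *)

Lemma unit_ball0 (R : realType) k (X : normedModType (scalar_field R k)) :
  unit_ball X 0.
Proof. by rewrite /unit_ball /= normr0. Qed.

(** Guarantees that the suprema over the ball are genuine upper bounds and not default values. *)
Lemma continuous_functional_bounded (R : realType) k
    (X : normedModType (scalar_field R k))
    (f : {linear X -> (scalar_field R k)^o}) : continuous f ->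
  exists M, forall x, unit_ball X x -> re `|f x| <= M.
Proof.
move=> /linear_bounded_continuous/linear_boundedP/pinfty_ex_gt0[r r0 fr].
exists (re r) => x x1; rewrite re_le// (le_trans (fr x))// ler_piMr//.
exact: ltW.
Qed.

Lemma functionalZ (R : realType) k (X : normedModType (scalar_field R k))
    (f : {linear X -> (scalar_field R k)^o}) (c : scalar_field R k) (x : X) :
  f (c *: x) = c * f x.
Proof. exact: linearZ. Qed.

(* Rotating [z] makes [f z] real and nonnegative. *)
Lemma sup_re_functional (R : realType) k (X : normedModType (scalar_field R k))
    (f : {linear X -> (scalar_field R k)^o}) : continuous f ->
  sup [set re (f z) | z in unit_ball X] = sup [set re `|f z| | z in unit_ball X].
Proof.
move=> /continuous_functional_bounded[M fM]; apply/eqP; rewrite eq_le.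
apply/andP; split; apply: ge_sup; try by eexists; exists 0 => //; exact: unit_ball0.
  move=> _ [z z1 <-]; rewrite (le_trans (re_le_norm _))//.
  by apply: ub_le_sup; [exists M => _ [w w1 <-]; exact: fM|exists z].
move=> _ [z z1 <-]; apply: ub_le_sup.
  by exists M => _ [w w1 <-]; rewrite (le_trans (re_le_norm _))// fM.
have [fz|fz] := eqVneq (f z) 0.
  by exists 0; [exact: unit_ball0|rewrite linear0 fz normr0].
exists ((`|f z| / f z) *: z); last by rewrite functionalZ -mulrA mulVf// mulr1.
by rewrite /unit_ball /= normrZ normrM normfV normr_id divff ?normr_eq0// mul1r.
Qed.

(** * The Daugavet equation for a rank-one operator *)

Theorem corollary4p13 (R : realType) (k : scalar_kind)
    (X : completeNormedModType (scalar_field R k)) (X_nonzero : exists x : X, x != 0)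
    (sup_max_eq2 : forall (x : X) (C : set X),
       unit_sphere X x -> is_convex_combination_of_slices C ->
       sup [set max_rotation_norm x y | y in C] = 2) :
  Daugavet_property X.
Proof.
move=> T Tc /(rank_one_functional Tc)[f [u [fc [x0 fx0] u1 TE]]].
have [M fM] := continuous_functional_bounded fc.
pose a := sup [set re `|f z| | z in unit_ball X].
have fa z : unit_ball X z -> re `|f z| <= a.
  by move=> z1; apply: ub_le_sup; [exists M => _ [w w1 <-]; exact: fM|exists z].
have Tn z : rnorm (T z) = re `|f z| by rewrite TE rnormZ u1 mulr1.
have -> : operator_norm T = a.
  by rewrite /operator_norm /a; congr sup; apply/seteqP; split=> _ [z z1 <-]; exists z.
(* Test [f] at the normalization of [x0]. Positivity is needed because [alpha] below has [a] in its
   denominator. *)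
have a0 : 0 < a.
  have x00 : x0 != 0 by apply: contra_neq fx0 => ->; rewrite linear0.
  have := fa (`|x0|^-1 *: x0); rewrite functionalZ => fxa; apply: lt_le_trans (fxa _); last first.
    by rewrite /unit_ball /= normrZ normfV normr_id mulVf// normr_eq0.
  rewrite lt_neqAle (@rnorm_ge0 R k (scalar_field R k)^o) andbT eq_sym.
  apply: contra_neq fx0 => h.
  have := of_real_re (normr_ge0 (`|x0|^-1 * f x0)); rewrite h.
  rewrite of_real0 => /esym/eqP; rewrite normr_eq0 mulf_eq0 invr_eq0.
  by rewrite normr_eq0 (negbTE x00) => /eqP.
have upper z : unit_ball X z -> rnorm (z + T z) <= 1 + a.
  by move=> z1; rewrite (le_trans (rnormD _ _))// lerD ?Tn ?fa//; exact/unit_ballE.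
apply/eqP; rewrite eq_le; apply/andP; split.
  apply: ge_sup; first by eexists; exists 0 => //; exact: unit_ball0.
  by move=> _ [z z1 <-]; exact: upper.
apply/ler_addgt0Pr => e e0.
have a10 : 0 < 1 + a by rewrite addr_gt0.
(* Half of the error [e] goes to [d], as [(1 + a) * (1 - d) = 1 + a - e / 2]; the other half pays
   for replacing [a] by [f y]. *)
pose d := e / 2 / (1 + a); have d0 : 0 < d by rewrite !divr_gt0.
(* From [re (f y) > a - alpha] and [|f y| <= a], the law of cosines gives
   [|f y - a| ^+ 2 <= 2 * a * alpha], and this equals [(e / 2) ^+ 2]. *)
pose alpha := e ^+ 2 / (8 * a).
have alpha0 : 0 < alpha by rewrite divr_gt0 ?exprn_gt0// mulr_gt0.
have fS : is_slice (slice f alpha) by exists f, alpha; split => //; exists x0.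
have [y [y1 fy] uy] := slice_near_opposite sup_max_eq2 (proj2 (unit_sphereE u) u1) fS d0.
rewrite sup_re_functional// -/a in fy.
have near_a : re `|f y - of_real k a| <= e / 2.
  have e2 : 0 <= e / 2 by rewrite divr_ge0// ltW.
  rewrite -(@ler_pXn2r _ 2)// ?nnegrE//; last first.
    exact: (@rnorm_ge0 R k (scalar_field R k)^o).
  rewrite sqr_norm_sub_of_real.
  have h1 : re `|f y| ^+ 2 <= a ^+ 2.
    rewrite ler_pXn2r// ?nnegrE ?(ltW a0) ?fa//.
    exact: (@rnorm_ge0 R k (scalar_field R k)^o).
  have h2 : 2 * a * (a - alpha) <= 2 * a * re (f y).
    by rewrite ler_wpM2l ?mulr_ge0 ?(ltW a0)// ltW.
  have h3 : 2 * a * (a - alpha) = 2 * a ^+ 2 - (e / 2) ^+ 2.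
    by rewrite /alpha; field; rewrite gt_eqF.
  by move: h1 h2; rewrite h3; lra.
have lower : (1 + a) * (1 - d) <= rnorm (y + of_real k a *: u).
  by apply: rnorm_unbalanced_sum; rewrite ?u1 ?(ltW a0)//; exact/unit_ballE.
(* The two vectors differ by [f y - a] times the unit vector [u]. *)
have : rnorm (y + of_real k a *: u) <= rnorm (y + T y) + e / 2.
  have -> : y + of_real k a *: u = (y + T y) - (f y - of_real k a) *: u.
    by rewrite TE scalerBl opprB -addrA [f y *: u + _]addrC subrK.
  by rewrite (le_trans (rnormD _ _))// lerD2l rnormN rnormZ u1 mulr1.
have : (1 + a) * (1 - d) = 1 + a - e / 2 by rewrite /d; field; rewrite gt_eqF.
have : rnorm (y + T y) <= operator_norm (fun x => x + T x).
  by apply: ub_le_sup; [exists (1 + a) => _ [z z1 <-]; exact: upper|exists y].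
by move: lower; lra.
Qed.
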